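(* Let $\{\mathfrak{n}_0=U\oplus\mathfrak{g}_0,\langle\,,\rangle\}$ be the real 2-step nilpotent Lie algebra described in the context, with $\mathfrak{h}_0$ a maximal abelian subalgebra of $\mathfrak{g}_0$, $\mathfrak{h}=\mathfrak{h}_0^{\mathbb{C}}$, roots $\Phi$ and nonzero weights $\Lambda$ of $V=U^{\mathbb{C}}$. Then, for the bracket of $\mathfrak{n}_0$: 1) $[U_\lambda,U_\lambda]=\mathbb{R}\text{-span}\{\tilde H_\lambda\}$ if $\lambda\in\Lambda$ and $2\lambda\notin\Phi$. 2) $[U_\beta,U_\beta]=\mathbb{R}\text{-span}\{\tilde H_\beta\}$ if $\beta\in\Lambda\cap\Phi$.
   Context: $\mathfrak{g}_0$ is a compact semisimple real Lie algebra (negative definite Killing form), $U$ a finite dimensional real $\mathfrak{g}_0$-module. $\langle\,,\rangle$ is a positive definite inner product on $\mathfrak{n}_0=U\oplus\mathfrak{g}_0$ such that $U\perp\mathfrak{g}_0$, every $X\in\mathfrak{g}_0$ acts skew symmetrically on $U$, and $\mathrm{ad}X:\mathfrak{g}_0\to\mathfrak{g}_0$ is skew symmetric for every $X\in\mathfrak{g}_0$. The bracket of $\mathfrak{n}_0$ is defined by: $\mathfrak{g}_0$ is central in $\mathfrak{n}_0$, $[\mathfrak{n}_0,\mathfrak{n}_0]\subseteq\mathfrak{g}_0$, and $\langle[u,u'],Z\rangle=\langle Z(u),u'\rangle$ for $u,u'\in U$, $Z\in\mathfrak{g}_0$. $\mathfrak{h}$ is a Cartan subalgebra of $\mathfrak{g}=\mathfrak{g}_0^{\mathbb{C}}$;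 $V_\lambda=\{v\in V:Hv=\lambda(H)v\ \forall H\in\mathfrak{h}\}$; $U_\lambda=(V_\lambda\oplus V_{-\lambda})\cap U$ for $\lambda\in\Lambda$. For $\lambda\in\Lambda$, $\lambda$ takes imaginary values on $\mathfrak{h}_0$, and $\tilde H_\lambda$ (the real weight vector) is the unique vector in $\mathfrak{h}_0$ with $\langle\tilde H,\tilde H_\lambda\rangle=-i\lambda(\tilde H)$ for all $\tilde H\in\mathfrak{h}_0$. For a subspace $A$, $[A,A]$ is the span of all brackets. *)

(* Defs.v *)
From HB Require Import structures.
From mathcomp Require Import all_boot all_order all_algebra.
From mathcomp Require Import sesquilinear complex.
From mathcomp Require Import boolp classical_sets reals.
Set Implicit Arguments.
Unset Strict Implicit.
Unset Printing Implicit Defensive.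
Import Order.TTheory GRing.Theory Num.Theory.
Local Open Scope ring_scope.
Local Open Scope classical_set_scope.

Section LieAlgebra.
Variables (R : fieldType) (L : vectType R).

Definition is_lie_bracket (br : {bilinear L -> L -> L}) : Prop :=
  (forall x, br x x = 0) /\
  (forall x y z, br x (br y z) + br y (br z x) + br z (br x y) = 0).

Definition is_lie_module (br : {bilinear L -> L -> L}) (W : vectType R)
    (act : {bilinear L -> W -> W}) : Prop :=
  forall x y w, act (br x y) w = act x (act y w) - act y (act x w).

(* The trace does not depend on the choice of the basis. *)
Definition lftrace (f : 'End(L)) : R :=
  \tr (passmx.mxof (vbasis {:L}) (vbasis {:L}) f).

Definition killing (br : {bilinear L -> L -> L}) (x y : L) : R :=
  lftrace (linfun (br x) \o linfun (br y))%VF.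

Definition abelian_subalgebra (br : {bilinear L -> L -> L})
    (h : {vspace L}) : Prop :=
  forall x y, x \in h -> y \in h -> br x y = 0.

Definition maximal_abelian_subalgebra (br : {bilinear L -> L -> L})
    (h : {vspace L}) : Prop :=
  abelian_subalgebra br h /\
  forall h' : {vspace L}, abelian_subalgebra br h' -> (h <= h')%VS -> h' = h.

(* Finite linear combinations of elements of an arbitrary set. *)
Definition linspan (S : set L) : set L :=
  [set x | exists2 s : seq L, (forall y, y \in s -> S y) & x \in <<s>>%VS].

End LieAlgebra.

Definition negative_definite (R : numDomainType) (L : lmodType R)
    (B : L -> L -> R) : Prop :=
  forall x, x != 0 -> B x x < 0.

(* The complexification of a real vector space W: the pair (x, y) stands for
   x + i y.  This is an alias of W * W which is a vector space over R[i] and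
   does not inherit the structure of vector space over R. *)
Section Complexification.
Variable R : rcfType.

Definition cplx (W : vectType R) : Type := (W * W)%type.

Section Instances.
Import VectorInternalTheory.
Variable W : vectType R.

HB.instance Definition _ := GRing.Zmodule.copy (cplx W) (W * W)%type.

Definition cplx_scale (c : R[i]) (v : cplx W) : cplx W :=
  let: (a +i* b)%C := c in (a *: v.1 - b *: v.2, a *: v.2 + b *: v.1).

Fact cplx_scaleA a b v : cplx_scale a (cplx_scale b v) = cplx_scale (a * b) v.
Proof.
case: a b v => [a a'] [b b'] [x y]; rewrite /cplx_scale /=; congr pair => /=.
  rewrite !scalerBr !scalerDr !scalerBl !scalerDl !scalerA.
  by rewrite !opprD [X in _ + X = _]addrC addrACA.
rewrite !scalerBr !scalerDr !scalerBl !scalerDl !scalerA.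
by rewrite [X in _ + X = _]addrC addrACA.
Qed.

Fact cplx_scale1 : left_id 1 cplx_scale.
Proof.
by case=> x y; rewrite /cplx_scale /= !scale1r !scale0r subr0 addr0.
Qed.

Fact cplx_scaleDr : right_distributive cplx_scale +%R.
Proof.
move=> [a b] [x y] [z t]; rewrite /cplx_scale /=; congr pair => /=.
  by rewrite !scalerDr opprD addrACA.
by rewrite !scalerDr addrACA.
Qed.

Fact cplx_scaleDl v : {morph cplx_scale^~ v : a b / a + b}.
Proof.
case: v => x y [a b] [c d]; rewrite /cplx_scale /=; congr pair => /=.
  by rewrite !scalerDl opprD addrACA.
by rewrite !scalerDl addrACA.
Qed.

HB.instance Definition _ := GRing.Zmodule_isLmodule.Build R[i] (cplx W)
  cplx_scaleA cplx_scale1 cplx_scaleDr cplx_scaleDl.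

Fact cplx_vect_iso : Vector.axiom (dim W) (cplx W).
Proof.
pose f (v : cplx W) : 'rV[R[i]]_(dim W) :=
  \row_j (v2r v.1 0 j +i* v2r v.2 0 j)%C.
pose g (r : 'rV[R[i]]_(dim W)) : cplx W :=
  (r2v (\row_j complex.Re (r 0 j)),
   r2v (\row_j complex.Im (r 0 j))).
exists f.
  move=> [a b] [x y] [z t]; apply/rowP => j; rewrite !mxE /=.
  by rewrite !linearD !linearN !linearZ /= !mxE /= mulrN.
exists g => [[x y]|r].
  rewrite /g /f; congr pair; apply: (canLR v2rK);
    by apply/rowP => j; rewrite !mxE.
apply/rowP => j; rewrite !mxE /= !r2vK !mxE.
by case: (r 0 j).
Qed.

HB.instance Definition _ := Lmodule_hasFinDim.Build R[i] (cplx W) cplx_vect_iso.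

End Instances.

(* The R[i]-bilinear extension of a real bilinear map. *)
Definition cplx_bilin (A B C : vectType R) (f : A -> B -> C)
    (x : cplx A) (y : cplx B) : cplx C :=
  (f x.1 y.1 - f x.2 y.2, f x.1 y.2 + f x.2 y.1).

Definition cplx_incl (W : vectType R) (h0 : {vspace W})
    (H : cplx (subvs_of h0)) : cplx W :=
  (vsval H.1, vsval H.2).

Definition real_part (W : vectType R) (x : W) : cplx W := (x, 0).

End Complexification.

Section Weights.
Variables (R : realType) (g0 : vectType R) (h0 : {vspace g0}).

(* The dual space of h = h0^C. *)
Definition hdual := 'Hom(cplx (subvs_of h0), R[i]^o).

Section WeightSpaces.
Variables (U : vectType R) (act : {bilinear g0 -> U -> U}).

Definition weight_space (lam : hdual) : set (cplx U) :=
  [set v | forall H, cplx_bilin act (cplx_incl H) v = lam H *: v].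

Definition nonzero_weights : set hdual :=
  [set lam | lam != 0 /\ exists2 v, v != 0 & weight_space lam v].

Definition real_weight_space (lam : hdual) : set U :=
  [set u | exists v w, [/\ weight_space lam v, weight_space (- lam) w
                         & real_part u = v + w]].

End WeightSpaces.

(* The roots are the nonzero weights of the adjoint module. *)
Definition lie_roots (br : {bilinear g0 -> g0 -> g0}) : set hdual :=
  nonzero_weights br.

Section TwoStep.
Variables (U : vectType R) (ip : {dot (U * g0)%type for idfun}).

(* The vector K of h0 with <H, K> = - i lam(H) for all H in h0; it is unique,
   and it exists when lam takes imaginary values on h0. *)
Definition real_weight_vector (lam : hdual) : subvs_of h0 :=
  xget 0 [set K | forall H : subvs_of h0,
    (ip (0, vsval H) (0, vsval K))%:C%C = - 'i%C * lam (real_part H)].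

End TwoStep.
End Weights.

Arguments nonzero_weights {R g0} h0 {U} act.
Arguments lie_roots {R g0} h0 br.

Section TwoStepStructure.
Variables (R : realType) (g0 U : vectType R).
Variable act : {bilinear g0 -> U -> U}.
Variable br : {bilinear g0 -> g0 -> g0}.
Variable ip : {dot (U * g0)%type for idfun}.

Definition admissible_inner_product : Prop :=
  [/\ forall u X, ip (u, 0) (0, X) = 0,
      forall X u u', ip (act X u, 0) (u', 0) = - ip (u, 0) (act X u', 0)
    & forall X Y Z, ip (0, br X Y) (0, Z) = - ip (0, Y) (0, br X Z)].

Definition is_two_step_bracket
    (nbr : {bilinear (U * g0)%type -> (U * g0)%type -> (U * g0)%type}) : Prop :=
  [/\ is_lie_bracket nbr,
      forall (Z : g0) x, nbr (0, Z) x = 0,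
      forall x y, (nbr x y).1 = 0
    & forall (u u' : U) (Z : g0),
        ip (nbr (u, 0) (u', 0)) (0, Z) = ip (act Z u, 0) (u', 0)].

(* U_lam seen in n0, and [A, A] for a subset A of n0. *)
Definition real_weight_space_n0 (h0 : {vspace g0}) (lam : hdual h0) :
    set (U * g0)%type :=
  [set (u, 0) | u in real_weight_space act lam].

Definition bracket_span
    (nbr : {bilinear (U * g0)%type -> (U * g0)%type -> (U * g0)%type})
    (A B : set (U * g0)%type) : set (U * g0)%type :=
  linspan [set nbr x y | x in A & y in B].

End TwoStepStructure.

(* Main.v *)
Require Import Defs.
From mathcomp Require Import all_boot all_order all_algebra.
From mathcomp Require Import sesquilinear complex.
From mathcomp Require Import boolp classical_sets reals.
From mathcomp Require Import ring lra.
Import Order.TTheory GRing.Theory Num.Theory.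
Set Implicit Arguments.
Unset Strict Implicit.
Unset Printing Implicit Defensive.
Local Open Scope ring_scope.
Local Open Scope classical_set_scope.

(** Why the proposition holds.  A weight vector a - i b of weight lam = i t
    (t real on the Cartan subalgebra h) amounts to a pair of real vectors with
    H a = t(H) b and H b = - t(H) a: a weight pair.  The real weight space
    U_lam consists of the first components of the weight pairs of U, so the
    whole argument can be run over the reals, on both U and g0.

    The bracket of U is characterised by <[u,v], X> = <X u, v>, and it follows
    from the skewness of the action that it is g0-equivariant.  The bracket of
    g0 itself satisfies the same identity for the adjoint action.  A bracket
    of this kind (a moment bracket, below) adds weights: the pairs (a, b) of
    weight t and (c, d) of weight s give a pair of weight t + s with components
    [a,c] - [b,d] and [a,d] + [b,c] (moment_weight_pair).

    If 2 lam is not a root, then for t = s this pair vanishes.  This makes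
    [a,c] commute with h, hence belong to h because h is maximal abelian.  An
    element of h is determined by its inner products with h, and
    <[a,c], H> = <H a, c> = t(H) <b, c>; thus [a,c] = <b,c> H~_lam
    (moment_eq_weight_vector).  The line is reached by [a,b] = <b,b> H~_lam.

    It remains to see that 2 beta is not a root when beta is
    (double_pair_eq0).  Let e = x - i y have weight beta and E = p - i q have
    weight 2 beta, f being the conjugate of e.  By invariance, [f,E] is
    orthogonal to e; an element of g_beta orthogonal to e is killed by f, and
    so it is a lowest weight vector with a positive weight for the sl2 spanned
    by e, f and [e,f].  Such a vector z is zero, since |[e,z]|^2 would be a
    negative multiple of |z|^2 (lowest_positive_pair_eq0).  Hence [f,E] = 0,
    and then E = 0 for the same reason. *)

(** * Inner products and moment brackets *)

(** A predicate rather than a structure, so that it applies to the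
    restrictions of one form on U * g0 to each of its two factors. *)
Record inner_product {R : numDomainType} {V : lmodType R}
    (f : V -> V -> R) : Prop :=
  InnerProduct {
    innerD : forall x y z, f (x + y) z = f x z + f y z;
    innerZ : forall c x y, f (c *: x) y = c * f x y;
    innerC : forall x y, f x y = f y x;
    inner_gt0 : forall x, x != 0 -> 0 < f x x }.

Section InnerProductTheory.
Context {R : numDomainType} {V : lmodType R} {f : V -> V -> R}.
Hypothesis f_ip : inner_product f.

Lemma inner0l x : f 0 x = 0.
Proof. by rewrite -(scale0r 0) (innerZ f_ip) mul0r. Qed.

Lemma innerNl x y : f (- x) y = - f x y.
Proof. by rewrite -scaleN1r (innerZ f_ip) mulN1r. Qed.

Lemma innerBl x y z : f (x - y) z = f x z - f y z.
Proof. by rewrite (innerD f_ip) innerNl. Qed.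

Lemma inner0r x : f x 0 = 0.
Proof. by rewrite (innerC f_ip) inner0l. Qed.

Lemma innerNr x y : f x (- y) = - f x y.
Proof. by rewrite !(innerC f_ip x) innerNl. Qed.

Lemma innerZr c x y : f x (c *: y) = c * f x y.
Proof. by rewrite !(innerC f_ip x) (innerZ f_ip). Qed.

Lemma inner_ge0 x : 0 <= f x x.
Proof.
by have [->|/(inner_gt0 f_ip)/ltW//] := eqVneq x 0; rewrite inner0l.
Qed.

Lemma inner_eq0 x : f x x = 0 -> x = 0.
Proof.
by move=> fx; apply: contra_eq fx => /(inner_gt0 f_ip); rewrite lt0r => /andP[].
Qed.

Lemma inner_ext x y : (forall z, f x z = f y z) -> x = y.
Proof.
move=> xy; apply/eqP; rewrite -subr_eq0; apply/eqP/inner_eq0.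
by rewrite innerBl xy subrr.
Qed.

End InnerProductTheory.

Definition skew_action {R : numDomainType} {A V : lmodType R}
    (act : A -> V -> V) (f : V -> V -> R) : Prop :=
  forall X u v, f (act X u) v = - f u (act X v).

(** mu is the moment map of the action, polarised: its component along X is
    the skew form attached to X.  The bracket of g0 (for the adjoint action)
    and that of the two-step algebra on U are the two instances of interest. *)
Definition moment_bracket {R : numDomainType} {A V : lmodType R}
    (act : A -> V -> V) (f : V -> V -> R) (g : A -> A -> R)
    (mu : V -> V -> A) : Prop :=
  forall u v X, g (mu u v) X = f (act X u) v.

(** * Weight pairs: weight vectors in real terms *)

Section WeightPairs.
Context {R : realFieldType} {g0 : vectType R}.
Variables (br : {bilinear g0 -> g0 -> g0}) (h : {vspace g0}).

(** Says that a - i b is a vector of weight i t in the complexification. *)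
Definition weight_pair {V : vectType R} (act : {bilinear g0 -> V -> V})
    (t : subvs_of h -> R) (a b : V) : Prop :=
  forall H, act (vsval H) a = t H *: b /\ act (vsval H) b = - t H *: a.

(** Complex conjugation of a - i b, which negates the weight. *)
Lemma weight_pair_conj {V : vectType R} (act : {bilinear g0 -> V -> V}) t a b :
  weight_pair act t a b -> weight_pair act (fun H => - t H) a (- b).
Proof.
move=> ab H; have [Ha Hb] := ab H.
by rewrite linearNr Ha Hb !scaleNr scalerN !opprK.
Qed.

(** Multiplication of a - i b by i. *)
Lemma weight_pair_rot {V : vectType R} (act : {bilinear g0 -> V -> V}) t a b :
  weight_pair act t a b -> weight_pair act t b (- a).
Proof.
move=> ab H; have [Ha Hb] := ab H.
by rewrite linearNr Ha Hb !scalerN !scaleNr.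
Qed.

Variable ipg : g0 -> g0 -> R.
Hypothesis br_lie : is_lie_bracket br.
Hypothesis h_max : maximal_abelian_subalgebra br h.
Hypothesis ipg_inner : inner_product ipg.
Hypothesis br_skew : skew_action br ipg.

Lemma lie_bracketC x y : br x y = - br y x.
Proof.
have [alt _] := br_lie; apply/eqP; rewrite -addr_eq0; apply/eqP.
have := alt (x + y).
by rewrite linearDl !linearD /= !alt add0r addr0.
Qed.

Lemma br_module : is_lie_module br br.
Proof.
have [_ jac] := br_lie => x y w.
apply/eqP; rewrite -subr_eq0 -oppr_eq0 -[X in _ == X](jac x y w).
rewrite (lie_bracketC w x) (lie_bracketC w (br x y)).
by rewrite linearNr !opprB.
Qed.

(** This lets the results on moment brackets apply to the roots of g0. *)
Lemma moment_br : moment_bracket br ipg ipg br.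
Proof.
move=> u v X; rewrite lie_bracketC (innerNl ipg_inner) br_skew opprK.
by rewrite lie_bracketC (innerNr ipg_inner) [RHS]br_skew.
Qed.

Lemma maximal_abelian_centralizer X :
  (forall H : subvs_of h, br (vsval H) X = 0) -> X \in h.
Proof.
have [h_ab h_maxl] := h_max; have [alt _] := br_lie => HX.
rewrite -(h_maxl (h + <[X]>)%VS) ?addvSl //.
  by apply/subvP: (memv_line X); apply: addvSr.
have hX H : H \in h -> br H X = 0 by move=> hH; have := HX (Subvs hH).
move=> _ _ /memv_addP[x hx [_ /vlineP[c ->] ->]]
  /memv_addP[y hy [_ /vlineP[d ->] ->]].
rewrite linearDl !linearD /= !linearZl_LR !linearZ /=.
by rewrite h_ab // hX // (lie_bracketC X) hX // alt !(oppr0, scaler0, addr0).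
Qed.

Section Moment.
Context {V : vectType R} {act : {bilinear g0 -> V -> V}}.
Context {ipV : V -> V -> R} {mu : V -> V -> g0}.
Hypothesis act_module : is_lie_module br act.
Hypothesis ipV_inner : inner_product ipV.
Hypothesis act_skew : skew_action act ipV.
Hypothesis muE : moment_bracket act ipV ipg mu.

(** The form on g0 is nondegenerate, so that the identities satisfied by a
    moment bracket, such as this one, can be tested against elements of g0. *)
Lemma momentZl c u v : mu (c *: u) v = c *: mu u v.
Proof.
apply: (inner_ext ipg_inner) => Z.
by rewrite (innerZ ipg_inner) !muE linearZ /= (innerZ ipV_inner).
Qed.

Lemma momentZr c u v : mu u (c *: v) = c *: mu u v.
Proof.
apply: (inner_ext ipg_inner) => Z.
by rewrite (innerZ ipg_inner) !muE (innerZr ipV_inner).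
Qed.

Lemma moment_equivariant X u v :
  br X (mu u v) = mu (act X u) v + mu u (act X v).
Proof.
apply: (inner_ext ipg_inner) => Z.
rewrite (innerD ipg_inner) !muE br_skew muE act_module (innerBl ipV_inner).
by rewrite [ipV (act X _) _]act_skew opprB opprK.
Qed.

(** The extension of mu to the complexifications sends (a - i b, c - i d) to
    the vector that this pair encodes, and it adds weights by equivariance. *)
Lemma moment_weight_pair t s a b c d :
    weight_pair act t a b -> weight_pair act s c d ->
  weight_pair br (fun H => t H + s H) (mu a c - mu b d) (mu a d + mu b c).
Proof.
move=> ab cd H; have [Ha Hb] := ab H; have [Hc Hd] := cd H.
rewrite linearBr linearDr !moment_equivariant Ha Hb Hc Hd !(momentZl, momentZr).
split; apply: (inner_ext ipg_inner) => Z;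
  rewrite !(innerD ipg_inner, innerNl ipg_inner, innerZ ipg_inner); ring.
Qed.

Lemma weight_pair_moment t a b (H : subvs_of h) :
  weight_pair act t a b -> ipg (mu a b) (vsval H) = t H * ipV b b.
Proof. by move=> ab; rewrite muE (ab H).1 (innerZ ipV_inner). Qed.

(** Up to a factor 2i, mu a b is the bracket of a - i b with its conjugate, so
    it has weight 0; such elements lie in h since h is its own centralizer. *)
Lemma moment_pair_in_cartan t a b : weight_pair act t a b -> mu a b \in h.
Proof.
move=> ab; apply: maximal_abelian_centralizer => H; have [Ha Hb] := ab H.
rewrite moment_equivariant Ha Hb momentZl momentZr.
apply: (inner_ext ipg_inner) => Z.
rewrite (innerD ipg_inner) !(innerZ ipg_inner) (inner0l ipg_inner) !muE.
have skew0 u : ipV (act Z u) u = 0.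
  by have := act_skew Z u u; rewrite (innerC ipV_inner u); lra.
by rewrite !skew0 !mulr0 addr0.
Qed.

Lemma weight_pair_eq0 t a b :
  weight_pair act t a b -> (exists H, t H != 0) -> (a == 0) = (b == 0).
Proof.
move=> ab [H tH]; have [Ha Hb] := ab H; apply/eqP/eqP => [a0|b0].
- by move/eqP: Ha; rewrite a0 linear0r eq_sym scaler_eq0 (negPf tH) => /eqP.
- move/eqP: Hb; rewrite b0 linear0r eq_sym scaler_eq0 oppr_eq0 (negPf tH).
  by move/eqP.
Qed.

End Moment.

(** Root spaces are orthogonal to h, as the action of h is skew and h is
    abelian. *)
Lemma weight_pair_orthogonal t a b (K : subvs_of h) :
    weight_pair br t a b -> (exists H, t H != 0) ->
  ipg a (vsval K) = 0 /\ ipg b (vsval K) = 0.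
Proof.
move=> ab [H tH]; have [Ha Hb] := ab H; have [h_ab _] := h_max.
have HK x : ipg (br (vsval H) x) (vsval K) = 0.
  by rewrite br_skew h_ab ?subvsP // (inner0r ipg_inner) oppr0.
have := HK a; have := HK b.
rewrite Ha Hb !(innerZ ipg_inner) => /eqP + /eqP.
by rewrite !mulf_eq0 oppr_eq0 (negPf tH) => /eqP-> /eqP->.
Qed.

(** With e = x - i y, f its conjugate and z = a - i b, the equations on
    brackets say that [f, z] = 0.  Then [e, z] has components 2 [x, a] and
    2 [y, a], and the invariance of the form turns the sum of the squared
    norms of the latter into - c t(K) |b|^2, where K = [x, y] lies in h
    and t(K) > 0.  So all terms vanish. *)
Lemma lowest_positive_pair_eq0 t s x y c a b :
    weight_pair br t x y -> (exists H, t H != 0) -> y != 0 ->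
    weight_pair br s a b -> (forall H, s H = c * t H) -> 0 < c ->
    br x a + br y b = 0 -> br x b = br y a ->
  b = 0.
Proof.
move=> xy t0 y0 ab sE c0 low1 low2; apply: (inner_eq0 ipg_inner).
have Kh := moment_pair_in_cartan br_module ipg_inner br_skew moment_br xy.
have KE H := weight_pair_moment ipg_inner moment_br H xy.
pose K : subvs_of h := Subvs Kh.
have yy : 0 < ipg y y := inner_gt0 ipg_inner y0.
(* <K, H> = t(H) <y, y>, and taking H = K determines the sign of t(K). *)
have tK : 0 < t K.
  rewrite -(pmulr_lgt0 _ yy) -(KE K); apply: (inner_gt0 ipg_inner).
  have [H tH] := t0; apply: contraNneq tH => xy0.
  have := KE H; rewrite xy0 (inner0l ipg_inner) => /esym/eqP.
  by rewrite mulf_eq0 (gt_eqF yy) orbF.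
have E : ipg (br x a) (br x a) + ipg (br y a) (br y a)
         = - (s K * ipg b b).
  rewrite -(innerZ ipg_inner) -(ab K).1 br_module (innerBl ipg_inner).
  rewrite (br_skew x _ b) (br_skew y _ b).
  have -> : br y b = - br x a by apply/eqP; rewrite -addr_eq0 addrC low1.
  by rewrite low2 (innerNr ipg_inner); ring.
have := inner_ge0 ipg_inner (br x a); have := inner_ge0 ipg_inner (br y a).
have := inner_ge0 ipg_inner b.
have sK : 0 < s K by rewrite sE mulr_gt0.
nra.
Qed.

(** Let e = x - i y, f its conjugate and E = p - i q.  Then [f, E] has the
    weight of e and is orthogonal to e, because <[f, E], e> is proportional
    to <E, [e, e]>.  The lemma above, applied to [f, E] and then to E, shows
    that both vanish. *)
Lemma double_pair_eq0 t x y p q :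
    weight_pair br t x y -> (exists H, t H != 0) -> y != 0 ->
    weight_pair br (fun H => 2 * t H) p q -> q = 0.
Proof.
move=> xy t0 y0 pq.
have K := moment_pair_in_cartan br_module ipg_inner br_skew moment_br xy.
have t20 : exists H, 2 * t H != 0.
  by have [H tH] := t0; exists H; rewrite mulf_neq0 ?pnatr_eq0.
have [pK qK] := weight_pair_orthogonal (Subvs K) pq t20.
(* a - i b is [E, f], where f is the conjugate of e = x - i y. *)
pose a := br p x - br q (- y); pose b := br p (- y) + br q x.
have ab : weight_pair br (fun H => 2 * t H - t H) a b.
  exact: (moment_weight_pair br_module ipg_inner br_skew moment_br
    pq (weight_pair_conj xy)).
have cyc u v w : ipg (br u v) w = ipg (br v w) u.
  by rewrite moment_br moment_br.
have brxx u : br u u = 0 by have [alt _] := br_lie.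
have xyp : ipg (br x y) p = 0 by rewrite (innerC ipg_inner).
have xyq : ipg (br x y) q = 0 by rewrite (innerC ipg_inner).
have yxp : ipg (br y x) p = 0.
  by rewrite lie_bracketC (innerNl ipg_inner) xyp oppr0.
have yxq : ipg (br y x) q = 0.
  by rewrite lie_bracketC (innerNl ipg_inner) xyq oppr0.
have inner0 := inner0l ipg_inner.
have [ax ay] : ipg a x = 0 /\ ipg a y = 0.
  rewrite /a linearNr opprK !(innerD ipg_inner) !(cyc p) !(cyc q).
  by rewrite !brxx !inner0 yxq xyp !addr0.
have [bx b_y] : ipg b x = 0 /\ ipg b y = 0.
  rewrite /b linearNr !(innerD ipg_inner) !(innerNl ipg_inner).
  rewrite !(cyc p) !(cyc q).
  by rewrite !brxx !inner0 yxp xyq oppr0 !addr0.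
(* [f, a - i b] has weight 0, so it lies in h; it is also orthogonal to h
   because a - i b is orthogonal to e.  Hence it is zero. *)
have low := moment_weight_pair br_module ipg_inner br_skew moment_br
  (weight_pair_conj xy) ab.
have inh u : (forall H : subvs_of h, br (vsval H) u = 0) ->
  (forall H : subvs_of h, ipg u (vsval H) = 0) -> u = 0.
  move=> /maximal_abelian_centralizer uh /(_ (Subvs uh)).
  exact: inner_eq0.
have a1 : br x a + br y b = 0.
  apply: inh => H; have [L1 L2] := low H; last first.
    rewrite (innerD ipg_inner) (moment_br x) (moment_br y) (xy H).1 (xy H).2.
    rewrite !(innerZ ipg_inner).
    by rewrite (innerC ipg_inner y) ay (innerC ipg_inner x) bx !mulr0 addr0.
  move: L1; rewrite linearNl opprK => ->.
  by rewrite (_ : _ + _ = 0) ?scale0r //; ring.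
have a2 : br x b - br y a = 0.
  apply: inh => H; have [L1 L2] := low H; last first.
    rewrite (innerBl ipg_inner) (moment_br x) (moment_br y) (xy H).1 (xy H).2.
    rewrite !(innerZ ipg_inner).
    by rewrite (innerC ipg_inner y) b_y (innerC ipg_inner x) ax !mulr0 subr0.
  move: L2; rewrite linearNl => ->.
  by rewrite (_ : _ + _ = 0) ?oppr0 ?scale0r //; ring.
have tab : weight_pair br t a b.
  by move=> H; have := ab H; rewrite (_ : 2 * t H - t H = t H) //; ring.
have b0 : b = 0.
  apply: (lowest_positive_pair_eq0 xy t0 y0 tab (c := 1)) => // [H|].
    by rewrite mul1r.
  by apply/eqP; rewrite -subr_eq0 a2.
have a0 : a = 0 by apply/eqP; rewrite (weight_pair_eq0 tab t0) b0.
have pxqy : br p x + br q y = 0 by rewrite -a0 /a linearNr opprK.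
have qxpy : br q x = br p y.
  by apply/eqP; rewrite -subr_eq0 -[X in _ == X]b0 /b linearNr addrC.
apply: (lowest_positive_pair_eq0 xy t0 y0 pq (c := 2)) => //.
  by rewrite (lie_bracketC x) (lie_bracketC y) -opprD pxqy oppr0.
by rewrite (lie_bracketC x) (lie_bracketC y) qxpy.
Qed.

Section CartanValued.
Context {V : vectType R} {act : {bilinear g0 -> V -> V}}.
Context {ipV : V -> V -> R} {mu : V -> V -> g0}.
Hypothesis act_module : is_lie_module br act.
Hypothesis ipV_inner : inner_product ipV.
Hypothesis act_skew : skew_action act ipV.
Hypothesis muE : moment_bracket act ipV ipg mu.

(** The obstruction to mu a c lying in h is the pair of weight 2t built from
    (a, b) and (c, d), which vanishes by hypothesis.  Inside h, mu a c is found
    from its inner products with h, which are t(H) <b, c>. *)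
Lemma moment_eq_weight_vector t a b c d (T : subvs_of h) :
    weight_pair act t a b -> weight_pair act t c d ->
    (forall p q, weight_pair br (fun H => 2 * t H) p q -> q = 0) ->
    (forall H : subvs_of h, ipg (vsval H) (vsval T) = t H) ->
  mu a c = ipV b c *: vsval T.
Proof.
move=> ab cd no2 TE.
have S0 : mu a d + mu b c = 0.
  apply: no2 (mu a c - mu b d) _ _ => H.
  have := moment_weight_pair act_module ipV_inner act_skew muE ab cd H.
  by rewrite (_ : t H + t H = 2 * t H) //; ring.
have ac_h : mu a c \in h.
  apply: maximal_abelian_centralizer => H.
  have [Ha _] := ab H; have [Hc _] := cd H.
  rewrite (moment_equivariant act_module ipV_inner act_skew muE) Ha Hc.
  rewrite (momentZl ipV_inner muE) (momentZr ipV_inner muE) -scalerDr addrC.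
  by rewrite S0 scaler0.
have h_ext (K L : subvs_of h) :
    (forall H : subvs_of h,
      ipg (vsval K) (vsval H) = ipg (vsval L) (vsval H)) ->
    vsval K = vsval L.
  move=> KL; apply/eqP; rewrite -subr_eq0; apply/eqP/(inner_eq0 ipg_inner).
  have := innerBl ipg_inner (vsval K) (vsval L) (vsval (K - L)).
  by rewrite (KL (K - L)) subrr linearB.
apply: (h_ext (Subvs ac_h) (ipV b c *: T)) => H /=.
rewrite muE (ab H).1 (innerZ ipV_inner) (innerZ ipg_inner).
by rewrite (innerC ipg_inner (vsval T)) TE mulrC.
Qed.

(** The bracket mu a b itself represents a positive multiple of t. *)
Lemma weight_vector_exists t a b :
    weight_pair act t a b -> b != 0 ->
  exists T : subvs_of h, forall H : subvs_of h, ipg (vsval H) (vsval T) = t H.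
Proof.
move=> ab /(inner_gt0 ipV_inner) bb.
have Kh := moment_pair_in_cartan act_module ipV_inner act_skew muE ab.
exists ((ipV b b)^-1 *: Subvs Kh) => H.
rewrite /= (innerZr ipg_inner) (innerC ipg_inner).
by rewrite (weight_pair_moment ipV_inner muE H ab) mulrCA mulVf ?mulr1 ?gt_eqF.
Qed.

End CartanValued.

End WeightPairs.

(** * From complex weights to weight pairs *)

Definition real_weight {R : realType} {g0 : vectType R} {h : {vspace g0}}
  (lam : hdual h) (H : subvs_of h) : R := complex.Im (lam (real_part H)).

Definition imaginary_on_cartan {R : realType} {g0 : vectType R}
    {h : {vspace g0}} (lam : hdual h) : Prop :=
  forall H : subvs_of h, complex.Re (lam (real_part H)) = 0.

Section RealWeights.
Context {R : realType} {g0 : vectType R} {h : {vspace g0}}.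
Implicit Types lam : hdual h.

Lemma imaginary_weightE lam (H : cplx (subvs_of h)) : imaginary_on_cartan lam ->
  lam H = (- real_weight lam H.2 +i* real_weight lam H.1)%C.
Proof.
move=> im; have HE : H = real_part H.1 + 'i%C *: real_part H.2.
  case: H => H1 H2; congr pair => /=.
    by rewrite !scale0r scaler0 subrr addr0.
  by rewrite scale0r scale1r !add0r.
rewrite [in LHS]HE linearD linearZ /= /real_weight.
have := im H.1; have := im H.2.
case: (lam (real_part H.1)) (lam (real_part H.2)) => r1 t1 [r2 t2] /= -> ->.
by congr (_ +i* _)%C => /=; ring.
Qed.

Lemma imaginaryN lam : imaginary_on_cartan lam -> imaginary_on_cartan (- lam).
Proof.
move=> im H; rewrite opp_lfunE; have := im H.
by case: (lam _) => r t /= ->; rewrite oppr0.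
Qed.

Lemma real_weightN lam H : real_weight (- lam) H = - real_weight lam H.
Proof. by rewrite /real_weight opp_lfunE; case: (lam _). Qed.

Lemma imaginary_double lam :
  imaginary_on_cartan lam -> imaginary_on_cartan (lam *+ 2).
Proof.
move=> im H; rewrite mulr2n add_lfunE; have := im H.
by case: (lam _) => r t /= ->; rewrite addr0.
Qed.

Lemma real_weight_double lam H :
  real_weight (lam *+ 2) H = 2 * real_weight lam H.
Proof.
by rewrite /real_weight mulr2n add_lfunE; case: (lam _) => r t /=; ring.
Qed.

Lemma imaginary_weight_neq0 lam : imaginary_on_cartan lam ->
  lam != 0 <-> exists H, real_weight lam H != 0.
Proof.
move=> im; split=> [|[H]]; last first.
  by apply: contraNneq => ->; rewrite /real_weight lfunE.
move=> lam0; apply: contrapT => t0; case/eqP: lam0.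
have {}t0 H : real_weight lam H = 0.
  by apply/eqP/negPn/negP => tH; apply: t0; exists H.
by apply/lfunP => H; rewrite imaginary_weightE // !t0 oppr0 lfunE.
Qed.

Context {U : vectType R} (act : {bilinear g0 -> U -> U}).

Lemma weight_space_pair lam a b : imaginary_on_cartan lam ->
  weight_space act lam (a, - b) <-> weight_pair act (real_weight lam) a b.
Proof.
move=> im; split=> [ab H|ab H].
  have := ab (real_part H); rewrite (imaginary_weightE _ im) /=.
  have -> : real_weight lam 0 = 0 by rewrite /real_weight linear0.
  rewrite /cplx_bilin /= !linear0l subr0 addr0 linearNr => -[-> E].
  split; first by rewrite oppr0 scale0r add0r scalerN opprK.
  by rewrite -[LHS]opprK E oppr0 scale0r add0r scaleNr.
have [H1a H1b] := ab H.1; have [H2a H2b] := ab H.2.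
rewrite (imaginary_weightE _ im) /cplx_bilin /= !linearNr H1a H1b H2a H2b.
congr pair => /=; rewrite ?scaleNr ?scalerN ?opprK //; first by rewrite addrC.
by rewrite addrC.
Qed.

Lemma weight_pairD (t : subvs_of h -> R) a b c d :
  weight_pair act t a b -> weight_pair act t c d ->
  weight_pair act t (a + c) (b + d).
Proof.
move=> ab cd H; have [Ha Hb] := ab H; have [Hc Hd] := cd H.
by rewrite !linearDr Ha Hb Hc Hd !scalerDr.
Qed.

Lemma weight_pairZ (t : subvs_of h -> R) k a b :
  weight_pair act t a b -> weight_pair act t (k *: a) (k *: b).
Proof.
move=> ab H; have [Ha Hb] := ab H.
by rewrite !linearZr_LR Ha Hb /= !scalerA ![k * _]mulrC.
Qed.

(** A real u = v + w with v of weight lam and w of weight - lam has twice the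
    imaginary part of w as its partner; conversely u is the sum of the
    halves of u - i u' and of its conjugate. *)
Lemma real_weight_space_pair lam u : imaginary_on_cartan lam ->
  real_weight_space act lam u <->
  exists u', weight_pair act (real_weight lam) u u'.
Proof.
move=> im; have imN := imaginaryN im; split=> [[v [w []]]|[u' uu']].
  case: v w => v1 v2 [w1 w2]; rewrite -[v2]opprK -[w2]opprK.
  move=> /(weight_space_pair _ _ im) pv /(weight_space_pair _ _ imN) pw [-> vw].
  exists (- v2 + w2); apply: weight_pairD pv _.
  have := weight_pair_conj pw; rewrite opprK => pw' H.
  by have := pw' H; rewrite real_weightN opprK.
have half := weight_pairZ (2^-1) uu'.
exists (2^-1 *: u, - (2^-1 *: u')), (2^-1 *: u, - - (2^-1 *: u')); split.
- exact/(weight_space_pair _ _ im).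
- apply/(weight_space_pair _ _ imN) => H; rewrite real_weightN.
  exact: (weight_pair_conj half).
- congr pair => /=; last by rewrite opprK addNr.
  by rewrite -scalerDl (_ : 2^-1 + 2^-1 = 1) ?scale1r //; field.
Qed.

Variable ipU : U -> U -> R.
Hypothesis ipU_inner : inner_product ipU.
Hypothesis act_skew : skew_action act ipU.

(** A skew operator has imaginary eigenvalues: for v = v1 + i v2 of eigenvalue
    r + i t, skewness at v1 and v2 gives r (|v1|^2 + |v2|^2) = 0. *)
Lemma weight_imaginary lam v :
  weight_space act lam v -> v != 0 -> imaginary_on_cartan lam.
Proof.
case: v => v1 v2 wv v0 H.
have := wv (real_part H); rewrite /cplx_bilin /= !linear0l subr0 addr0.
case: (lam (real_part H)) => r t [E1 E2] /=.
have skew0 u : ipU (act (vsval H) u) u = 0.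
  by have := act_skew (vsval H) u u; rewrite (innerC ipU_inner u); lra.
have := skew0 v1; have := skew0 v2; rewrite E1 E2.
rewrite !(innerD ipU_inner, innerNl ipU_inner, innerZ ipU_inner).
rewrite (innerC ipU_inner v2 v1) => S2 S1.
have /eqP : r * (ipU v1 v1 + ipU v2 v2) = 0 by rewrite mulrDr; lra.
rewrite mulf_eq0 => /orP[/eqP//|].
have n1 := inner_ge0 ipU_inner v1; have n2 := inner_ge0 ipU_inner v2.
rewrite paddr_eq0 // => /andP[/eqP v1v1 /eqP v2v2].
move/eqP: v0.
by rewrite (inner_eq0 ipU_inner v1v1) (inner_eq0 ipU_inner v2v2).
Qed.

Lemma nonzero_weights_pair lam : nonzero_weights h act lam <->
  [/\ imaginary_on_cartan lam, exists H, real_weight lam H != 0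
    & exists a b, b != 0 /\ weight_pair act (real_weight lam) a b].
Proof.
split=> [[lam0 [v v0 wv]]|[im t0 [a [b [b0 ab]]]]].
  have im := weight_imaginary wv v0.
  have t0 := (imaginary_weight_neq0 im).1 lam0; split=> //.
  case: v v0 wv => a b ab0; rewrite -[b]opprK => /(weight_space_pair _ _ im) ab.
  exists a, (- b); split=> //; apply: contra_neq ab0 => b0.
  have /eqP a0 : a == 0 by rewrite (weight_pair_eq0 ab t0) b0.
  by rewrite a0 -[b]opprK b0 oppr0.
split; first exact/imaginary_weight_neq0.
exists (a, - b); last exact/weight_space_pair.
by apply: contra_neq b0 => -[_ /eqP]; rewrite oppr_eq0 => /eqP.
Qed.

End RealWeights.

(** * The two-step nilpotent algebra *)

(** Reduces an equality of spans to a bracket computation: every generator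
    lies on the line of y, and one of them spans it. *)
Lemma linspan_eq_line {R : fieldType} {L : vectType R} (S : set L) (y : L) :
    (forall x, S x -> x \in <[y]>%VS) -> (exists2 x, S x & y \in <[x]>%VS) ->
  linspan S = linspan [set y].
Proof.
move=> Sy [x0 Sx0 yx0]; apply/seteqP; split=> x [s ss xs].
  exists [:: y] => [z|]; first by rewrite inE => /eqP.
  by rewrite span_seq1; apply: subvP xs; apply/span_subvP => z /ss/Sy.
exists [:: x0] => [z|]; first by rewrite inE => /eqP->.
by rewrite span_seq1; apply: subvP xs; apply/span_subvP => z /ss ->.
Qed.

Section TwoStepAlgebra.
Context {R : realType} {g0 U : vectType R}.
Variables (br : {bilinear g0 -> g0 -> g0}) (act : {bilinear g0 -> U -> U}).
Variable ip : {dot (U * g0)%type for idfun}.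
Variable nbr : {bilinear (U * g0)%type -> (U * g0)%type -> (U * g0)%type}.
Variable h0 : {vspace g0}.
Hypothesis g0_lie : is_lie_bracket br.
Hypothesis U_module : is_lie_module br act.
Hypothesis ip_adm : admissible_inner_product act br ip.
Hypothesis n0_bracket : is_two_step_bracket act ip nbr.
Hypothesis h0_max : maximal_abelian_subalgebra br h0.

Let ipU (u v : U) := ip (u, 0) (v, 0).
Let ipg (X Y : g0) := ip (0, X) (0, Y).
Let mu (u v : U) := (nbr (u, 0) (v, 0)).2.

Lemma dot_inner_product : inner_product ip.
Proof.
split=> [x y z|c x y|x y|x x0].
- by rewrite linearDl.
- by rewrite linearZl_LR.
- by rewrite hermC expr0 mul1r.
- exact: neq0_dnorm_gt0.
Qed.

Lemma ipU_inner : inner_product ipU.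
Proof.
have ipi := dot_inner_product; split=> [x y z|c x y|x y|x x0].
- by rewrite /ipU -(innerD ipi); congr (ip _ _); congr pair; rewrite /= addr0.
- by rewrite /ipU -(innerZ ipi); congr (ip _ _); congr pair; rewrite /= scaler0.
- exact: (innerC ipi).
- by apply: (inner_gt0 ipi); apply: contra_neq x0 => -[].
Qed.

Lemma ipg_inner : inner_product ipg.
Proof.
have ipi := dot_inner_product; split=> [x y z|c x y|x y|x x0].
- by rewrite /ipg -(innerD ipi); congr (ip _ _); congr pair; rewrite /= addr0.
- by rewrite /ipg -(innerZ ipi); congr (ip _ _); congr pair; rewrite /= scaler0.
- exact: (innerC ipi).
- by apply: (inner_gt0 ipi); apply: contra_neq x0 => -[].
Qed.

Lemma act_skew : skew_action act ipU.
Proof. by have [_ + _] := ip_adm. Qed.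

Lemma br_skew : skew_action br ipg.
Proof. by have [_ _] := ip_adm. Qed.

Lemma nbrE u v : nbr (u, 0) (v, 0) = (0, mu u v).
Proof.
have [_ _ n1 _] := n0_bracket.
by rewrite -(n1 (u, 0) (v, 0)) -surjective_pairing.
Qed.

Lemma mu_moment : moment_bracket act ipU ipg mu.
Proof.
by move=> u v X; have [_ _ _ n2] := n0_bracket; rewrite /ipg -nbrE n2.
Qed.

Lemma real_weight_vectorE lam : nonzero_weights h0 act lam ->
  forall H : subvs_of h0,
    ipg (vsval H) (vsval (real_weight_vector ip lam)) = real_weight lam H.
Proof.
move=> /(nonzero_weights_pair ipU_inner act_skew)[im _ [a [b [b0 ab]]]].
have [T TE] := weight_vector_exists g0_lie h0_max ipg_inner br_skew U_module
  ipU_inner act_skew mu_moment ab b0.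
have rhsE H : - 'i%C * lam (real_part H) = (real_weight lam H)%:C%C.
  have := im H; rewrite /real_weight; case: (lam _) => r t /= ->.
  by congr (_ +i* _)%C => /=; ring.
rewrite /real_weight_vector; set P := (P in xget 0 P) => H.
have PT : P T by move=> K; rewrite rhsE -TE.
by apply: complexI; rewrite -rhsE; apply: (xgetI 0 PT).
Qed.

Lemma bracket_span_weight lam :
    nonzero_weights h0 act lam -> ~ lie_roots h0 br (lam *+ 2) ->
  bracket_span nbr (real_weight_space_n0 act lam) (real_weight_space_n0 act lam)
  = linspan [set (0, vsval (real_weight_vector ip lam))].
Proof.
move=> Llam no2.
have [im t0 [a [b [b0 ab]]]] :=
  (nonzero_weights_pair ipU_inner act_skew _).1 Llam.
have TE := real_weight_vectorE Llam; set T := real_weight_vector ip lam in TE *.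
have muT u v c d : weight_pair act (real_weight lam) u v ->
    weight_pair act (real_weight lam) c d ->
  nbr (u, 0) (c, 0) = ipU v c *: ((0, vsval T) : U * g0).
  move=> uv cd; rewrite nbrE; congr pair; first by rewrite /= scaler0.
  apply: (moment_eq_weight_vector g0_lie h0_max ipg_inner br_skew U_module
    ipU_inner act_skew mu_moment uv cd _ TE) => p q pq.
  apply/eqP; apply: contra_notT no2 => q0.
  apply/(nonzero_weights_pair ipg_inner br_skew); split.
  - exact: imaginary_double.
  - have [H tH] := t0; exists H.
    by rewrite real_weight_double mulf_neq0 ?pnatr_eq0.
  - by exists p, q; split=> // H; rewrite real_weight_double; apply: pq.
apply: linspan_eq_line.
  move=> z [x [u + <-] [y [v + <-] <-]].
  move=> /(real_weight_space_pair _ _ im)[u' uu'].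
  move=> /(real_weight_space_pair _ _ im)[v' vv'].
  by apply/vlineP; exists (ipU u' v); apply: muT uu' vv'.
exists (nbr (a, 0) (b, 0)).
  exists (a, 0).
    by exists a => //; apply/real_weight_space_pair => //; exists b.
  exists (b, 0) => //; exists b => //; apply/real_weight_space_pair => //.
  by exists (- a); apply: weight_pair_rot.
rewrite (muT _ _ _ _ ab (weight_pair_rot ab)); apply/vlineP.
exists (ipU b b)^-1; rewrite scalerA mulVf ?scale1r //.
by rewrite gt_eqF // (inner_gt0 ipU_inner).
Qed.

Lemma double_root_not_root beta :
  lie_roots h0 br beta -> ~ lie_roots h0 br (beta *+ 2).
Proof.
move=> /(nonzero_weights_pair ipg_inner br_skew)[im t0 [x [y [y0 xy]]]].
move=> /(nonzero_weights_pair ipg_inner br_skew)[_ _ [p [q [/eqP q0 pq]]]].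
apply: q0.
apply: (double_pair_eq0 g0_lie h0_max ipg_inner br_skew xy t0 y0 (p := p)).
by move=> H; have := pq H; rewrite real_weight_double.
Qed.

End TwoStepAlgebra.

Theorem proposition6p10 (R : realType) (g0 U : vectType R)
  (br : {bilinear g0 -> g0 -> g0}) (act : {bilinear g0 -> U -> U})
  (ip : {dot (U * g0)%type for idfun})
  (nbr : {bilinear (U * g0)%type -> (U * g0)%type -> (U * g0)%type})
  (h0 : {vspace g0})
  (g0_lie : is_lie_bracket br)
  (g0_compact : negative_definite (killing br))
  (U_module : is_lie_module br act)
  (ip_adm : admissible_inner_product act br ip)
  (n0_bracket : is_two_step_bracket act ip nbr)
  (h0_max : maximal_abelian_subalgebra br h0) :
  let Phi := lie_roots h0 br in
  let Lambda := nonzero_weights h0 act in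
  let Un (lam : hdual h0) := real_weight_space_n0 act lam in
  let Ht (lam : hdual h0) : U * g0 := (0, vsval (real_weight_vector ip lam)) in
  (forall lam : hdual h0, Lambda lam -> ~ Phi (lam *+ 2) ->
     bracket_span nbr (Un lam) (Un lam) = linspan [set Ht lam]) /\
  (forall beta : hdual h0, (Lambda `&` Phi) beta ->
     bracket_span nbr (Un beta) (Un beta) = linspan [set Ht beta]).
Proof.
move=> Phi Lambda Un Ht; split=> [lam|beta [Lbeta Pbeta]].
  exact: (bracket_span_weight g0_lie U_module ip_adm n0_bracket h0_max).
apply: (bracket_span_weight g0_lie U_module ip_adm n0_bracket h0_max) => //.
exact: (double_root_not_root g0_lie ip_adm h0_max Pbeta).
Qed.
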